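(* Let $m$ be a polyhedral surface with Gauss image $s$ (a mesh parallel to $m$), and let $H_0\neq0$ be a real number. The pair $(m,s)$ has constant mean curvature $H_0$ if and only if $m$ is a discrete Koenigs net and its parallel surface $m^{1/H_0}=m+\frac1{H_0}s$ is a Christoffel dual of $m$: $$m^*=m+\frac1{H_0}s.$$ In this case, the mean curvature of this parallel surface with the reversed Gauss map, i.e. of the pair $(m+H_0^{-1}s,\,-s)$, is also constant and equal to $H_0$. The mid-surface $m+(2H_0)^{-1}s$ has constant positive Gaussian curvature $K_0=4H_0^2$ with respect to the same Gauss map $s$.
   Context: Mesh combinatorics: a 2-dimensional cell complex $(V,E,F)$. A mesh is a map $m:V\to\mathbb{R}^3$, $i\mapsto m_i$; for a face $f=(i_1,\dots,i_n)$, $m(f)=(m_{i_1},\dots,m_{i_n})$. A mesh is a polyhedral surface if the vertices of each face are mapped to coplanar points. Meshes $m,s$ are parallel if for each edge $(i,j)\in E$ the vectors $m_i-m_j$, $s_i-s_j$ are linearly dependent. $m$ is assumed to have no zero edges, and corresponding faces $m(f)$, $s(f)$ lie in planes parallel to a common 2-dimensional subspace $U_f$. Linear combinations of meshes are vertex-wise. Oriented area in $U_f$ (up to translation): $A(P)=\frac12\sum_i\det(p_i,p_{i+1})$ (indices mod $n$) for $P=(p_0,\dots,p_{n-1})$; $A(P,Q)$ is the associated symmetric bilinear form (mixed area). For a pair $(m,s)$ the mean and Gaussian curvatures of a face are $H_f=-A(m(f),s(f))/A(m(f))$ and $K_f=A(s(f))/A(m(f))$; they are defined only for faces with $A(m(f))\ne0$,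 and all faces whose curvatures are considered (of $m$, of the parallel surface, of the mid-surface) are assumed to have nonvanishing area. A pair has constant mean (resp. Gaussian) curvature $c$ if $H_f=c$ (resp. $K_f=c$) for all faces. Polyhedral surfaces $m,m'$ are Christoffel dual, $m'=m^*$, if they are parallel and $A(m(f),m'(f))=0$ for all faces $f$. A (discrete) Koenigs net is a polyhedral surface possessing a Christoffel dual. *)

(* Defs.v *)
From HB Require Import structures.
From mathcomp Require Import all_boot all_order all_algebra.
From mathcomp Require Import reals.

Set Implicit Arguments.
Unset Strict Implicit.
Unset Printing Implicit Defensive.
Import Order.TTheory GRing.Theory Num.Theory.
Local Open Scope ring_scope.

(* Polygonal 2-dimensional cell complex.  The boundary of the face [f] is the
   cyclic sequence of the vertices [bd k], [k : 'I_n], with [n = arity f]; [ordS] is the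
   successor modulo [n].  Vertices may be infinite in number, and the boundary
   is a closed edge path that need not be injective on vertices. *)
Record cell_complex := CellComplex {
  vertex : Type;
  edge : vertex -> vertex -> Prop;
  face : Type;
  arity : face -> nat;
  bd : forall f : face, 'I_(arity f) -> vertex;
  edge_sym : forall i j, edge i j -> edge j i;
  arity_ge3 : forall f, (3 <= arity f)%N;
  bd_edge : forall (f : face) (k : 'I_(arity f)), edge (bd k) (bd (ordS k))
}.

Definition polygon (R : realType) (n : nat) := {ffun 'I_n -> 'rV[R]_3}.

Definition mesh (R : realType) (K : cell_complex) := vertex K -> 'rV[R]_3.

Section Polygons.
Context {R : realType}.

(* An oriented 2-dimensional subspace of R^3, given as the row space of a matrix
   whose two rows form a positively oriented orthonormal basis. *)
Record oplane := OPlane {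
  frame :> 'M[R]_(2, 3);
  frame_orthonormal : frame *m frame^T = 1%:M
}.

(* [P] lies in an affine plane with direction space the row space of [W]
   (provided [W] has rank 2). *)
Definition parallel_to n (W : 'M[R]_(2, 3)) (P : polygon R n) : Prop :=
  forall i j, (P i - P j <= W)%MS.

Definition coplanar n (P : polygon R n) : Prop :=
  exists2 W : 'M[R]_(2, 3), \rank W = 2%N & parallel_to W P.

(* [u *m U^T] is the row of coordinates, in the frame of [U], of the orthogonal
   projection of [u] to [U]; on a polygon parallel to [U] this projection is a
   translation into [U]. *)
Definition area_form (U : oplane) (u v : 'rV[R]_3) : R :=
  \det (col_mx (u *m U^T) (v *m U^T) : 'M[R]_2).

Definition area n (U : oplane) (P : polygon R n) : R :=
  2^-1 * \sum_(i < n) area_form U (P i) (P (ordS i)).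

(* Polarization of the quadratic form [area U]. *)
Definition mixed_area n (U : oplane) (P Q : polygon R n) : R :=
  2^-1 * (area U (P + Q) - area U P - area U Q).

End Polygons.
Arguments oplane R : clear implicits.

Section Meshes.
Context {R : realType} {K : cell_complex}.
Implicit Types (m s : mesh R K) (f : face K) (U : face K -> oplane R).

Definition mface m f : polygon R (arity f) := [ffun k => m (bd k)].

Definition polyhedral m : Prop := forall f, coplanar (mface m f).

Definition nonzero_edges m : Prop :=
  forall i j : vertex K, edge i j -> m i != m j.

Definition parallel_meshes m s : Prop :=
  forall i j : vertex K, edge i j -> ~~ row_free (col_mx (m i - m j) (s i - s j)).

Definition common_planes U m s : Prop :=
  forall f, parallel_to (U f) (mface m f) /\ parallel_to (U f) (mface s f).

Definition nonvanishing_area U m : Prop :=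
  forall f, area (U f) (mface m f) != 0.

Definition mean_curvature U m s f : R :=
  - mixed_area (U f) (mface m f) (mface s f) / area (U f) (mface m f).

Definition gauss_curvature U m s f : R :=
  area (U f) (mface s f) / area (U f) (mface m f).

Definition const_mean_curvature U m s (c : R) : Prop :=
  forall f, mean_curvature U m s f = c.

Definition const_gauss_curvature U m s (c : R) : Prop :=
  forall f, gauss_curvature U m s f = c.

Definition offset_mesh m (t : R) s : mesh R K := fun i => m i + t *: s i.

Definition opp_mesh s : mesh R K := fun i => - s i.

(* Whether the mixed area vanishes does not depend on the orientation of the
   common plane.  The dual [m'] may have zero edges. *)
Definition christoffel_dual m m' : Prop :=
  [/\ polyhedral m, polyhedral m', parallel_meshes m m' &
      forall f, exists U : oplane R,
        [/\ parallel_to U (mface m f), parallel_to U (mface m' f) &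
            mixed_area U (mface m f) (mface m' f) = 0]].

Definition koenigs_net m : Prop :=
  polyhedral m /\ exists m', christoffel_dual m m'.

End Meshes.

(* Main.v *)
Require Import Defs.
From HB Require Import structures.
From mathcomp Require Import all_boot all_order all_algebra.
From mathcomp Require Import reals.
From mathcomp Require Import ring.

Set Implicit Arguments.
Unset Strict Implicit.
Unset Printing Implicit Defensive.
Import Order.TTheory GRing.Theory Num.Theory.
Local Open Scope ring_scope.

(** The mixed area is a symmetric bilinear form whose diagonal is the area, so
    the whole theorem is the calculus of a quadratic form along the line of
    parallel surfaces m + t s.  Since A(m, m + t s) = A(m) + t A(m, s), the
    condition A(m, s) = - H0 A(m) says exactly that A(m, m + t s) vanishes for
    t = 1 / H0; substituting this value of A(m, s) into
    A(m + t s) = A(m) + 2 t A(m, s) + t ^ 2 A(s) gives the curvatures of the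
    parallel surface and of the mid-surface.  The surface m is a
    Koenigs net because the parallel surface is itself a Christoffel dual of it.

    One point is geometric.  Christoffel duality of m and m + s / H0 provides, in
    each face, some common plane in which the mixed area vanishes, while the
    curvatures are measured in the prescribed plane U f.  As the face has
    nonzero area, two of its chords already span U f ([area_neq0_submx]), so
    that every plane parallel to the face contains U f; and passing to another
    frame multiplies all areas by a determinant ([mixed_area_frame]), hence
    preserves the vanishing of the mixed area. *)

(** * Mixed area as a symmetric bilinear form *)

Section MixedArea.
Context {R : realType}.
Implicit Types (U V : oplane R) (u v w : 'rV[R]_3).

Lemma det_mx2 (A : 'M[R]_2) : \det A = A 0 0 * A 1 1 - A 0 1 * A 1 0.
Proof.
rewrite (expand_det_row _ 0) big_ord_recl big_ord1 /cofactor !det_mx11 !mxE.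
rewrite expr0 expr1 mul1r mulN1r mulrN.
by congr (A _ _ * A _ _ - A _ _ * A _ _); apply: val_inj.
Qed.

Lemma area_formE U u v : area_form U u v =
  (u *m U^T) 0 0 * (v *m U^T) 0 1 - (u *m U^T) 0 1 * (v *m U^T) 0 0.
Proof.
rewrite /area_form det_mx2.
have r0 : (0 : 'I_2) = lshift 1 (0 : 'I_1) by apply: val_inj.
have r1 : (1 : 'I_2) = rshift 1 (0 : 'I_1) by apply: val_inj.
have e0 j : col_mx (u *m U^T) (v *m U^T) (0 : 'I_2) j = (u *m U^T) 0 j.
  by rewrite r0 (@col_mxEu R 1 1).
have e1 j : col_mx (u *m U^T) (v *m U^T) (1 : 'I_2) j = (v *m U^T) 0 j.
  by rewrite r1 (@col_mxEd R 1 1).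
by rewrite !e0 !e1.
Qed.

Lemma area_formDl U u v w :
  area_form U (u + v) w = area_form U u w + area_form U v w.
Proof. by rewrite !area_formE !mulmxDl !mxE; ring. Qed.

Lemma area_formDr U u v w :
  area_form U w (u + v) = area_form U w u + area_form U w v.
Proof. by rewrite !area_formE !mulmxDl !mxE; ring. Qed.

Lemma area_formZl U (a : R) u w : area_form U (a *: u) w = a * area_form U u w.
Proof. by rewrite !area_formE -!scalemxAl !mxE; ring. Qed.

Lemma area_formZr U (a : R) u w : area_form U w (a *: u) = a * area_form U w u.
Proof. by rewrite !area_formE -!scalemxAl !mxE; ring. Qed.

Lemma area_form_alt U u : area_form U u u = 0.
Proof. by rewrite area_formE; ring. Qed.

Lemma area_form_frame U V (T : 'M[R]_2) u v :
  U = T *m V :> 'M_(2, 3) -> area_form U u v = \det T * area_form V u v.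
Proof.
move=> eUV; rewrite /area_form eUV trmx_mul !mulmxA -mul_col_mx det_mulmx.
by rewrite det_tr mulrC.
Qed.

Context {n : nat}.
Implicit Types P Q : polygon R n.

Lemma mixed_areaE U P Q : mixed_area U P Q = 4^-1 *
  \sum_(i < n) (area_form U (P i) (Q (ordS i)) + area_form U (Q i) (P (ordS i))).
Proof.
rewrite /mixed_area /area -!mulrBr -!sumrB mulrA.
congr (_ * _); first by rewrite -invfM -natrM.
by apply: eq_bigr => i _; rewrite !ffunE area_formDl !area_formDr; ring.
Qed.

Lemma mixed_areaC U P Q : mixed_area U P Q = mixed_area U Q P.
Proof.
by rewrite !mixed_areaE; congr (_ * _); apply: eq_bigr => i _; rewrite addrC.
Qed.

Lemma mixed_area_diag U P : mixed_area U P P = area U P.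
Proof.
rewrite mixed_areaE big_split /= /area.
by field.
Qed.

Lemma mixed_areaDr U P Q Q' :
  mixed_area U P (Q + Q') = mixed_area U P Q + mixed_area U P Q'.
Proof.
rewrite !mixed_areaE -mulrDr -big_split /=; congr (_ * _).
by apply: eq_bigr => i _; rewrite !ffunE area_formDl area_formDr; ring.
Qed.

Lemma mixed_areaZr U (t : R) P Q : mixed_area U P (t *: Q) = t * mixed_area U P Q.
Proof.
rewrite !mixed_areaE mulrCA [in RHS]mulr_sumr; congr (_ * _).
by apply: eq_bigr => i _; rewrite !ffunE area_formZl area_formZr mulrDr.
Qed.

Lemma area_offset U P Q (t : R) : area U (P + t *: Q) =
  area U P + 2 * t * mixed_area U P Q + t ^+ 2 * area U Q.
Proof.
rewrite -!mixed_area_diag mixed_areaDr mixed_areaZr.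
rewrite ![mixed_area U (_ + _) _]mixed_areaC.
by rewrite !mixed_areaDr !mixed_areaZr [mixed_area U Q P]mixed_areaC; ring.
Qed.

Lemma mixed_area_frame U V (T : 'M[R]_2) P Q :
  U = T *m V :> 'M_(2, 3) -> mixed_area U P Q = \det T * mixed_area V P Q.
Proof.
move=> eUV; rewrite !mixed_areaE mulrCA [in RHS]mulr_sumr; congr (_ * _).
by apply: eq_bigr => i _; rewrite !(area_form_frame _ _ eUV) mulrDr.
Qed.

(** The area does not depend on the origin: the terms linear in the
    translation [w] cancel because the polygon is closed, [ordS] being a
    permutation of the indices. *)
Lemma area_translate U P w :
  area U P = 2^-1 * \sum_(i < n) area_form U (P i - w) (P (ordS i) - w).
Proof.
have eS F : \sum_(i < n) F (ordS i) = \sum_(i < n) F i :> R.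
  by rewrite [RHS](reindex_inj (@ordS_inj n)).
rewrite /area; congr (_ * _); symmetry.
under eq_bigr => i _.
  rewrite -!scaleN1r area_formDl !area_formDr !area_formZl !area_formZr.
  rewrite area_form_alt !mulr0 addr0 addrAC -addrA.
  over.
rewrite big_split /= -[RHS]addr0; congr (_ + _); rewrite big_split /=.
rewrite (eS (fun i => -1 * area_form U w (P i))) -big_split /=.
by rewrite big1 // => i _; rewrite !area_formE; ring.
Qed.

(** By [area_translate], the area is a sum of determinants of pairs of chords
    issuing from one vertex.  If it is nonzero, some such pair projects to a basis
    of the plane, so it spans all of [U]; both chords also lie in [W]. *)
Lemma area_neq0_submx U (W : 'M[R]_(2, 3)) P :
  area U P != 0 -> parallel_to U P -> parallel_to W P -> (U <= W)%MS.
Proof.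
move=> areaN0 PU PW.
have [i i_chord] : exists i : 'I_n, exists j,
    area_form U (P i - P j) (P (ordS i) - P j) != 0.
  case: (pickP (fun ij : 'I_n * 'I_n =>
      area_form U (P ij.1 - P ij.2) (P (ordS ij.1) - P ij.2) != 0)).
    by case=> i j nz; exists i, j.
  move=> all0; case/eqP: areaN0; case: (posnP n) => [n0|n_gt0].
    by rewrite /area big1 ?mulr0 // => i; have := ltn_ord i; rewrite {2}n0.
  rewrite (area_translate U P (P (Ordinal n_gt0))) big1 ?mulr0 // => i _.
  by apply/eqP; have /negbFE := all0 (i, Ordinal n_gt0).
case: i_chord => j; set E := col_mx (P i - P j) (P (ordS i) - P j).
rewrite /area_form -mul_col_mx -/E -unitfE -unitmxE => unitEU.
have EU : (E <= U)%MS by rewrite col_mx_sub !PU.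
have EW : (E <= W)%MS by rewrite col_mx_sub !PW.
apply: submx_trans EW; rewrite -(geq_leqif (mxrank_leqif_sup EU)).
apply: leq_trans (rank_leq_row _) _.
by rewrite -{1}(mxrank_unit unitEU) mxrankM_maxl.
Qed.

Lemma rank_frame U : \rank U = 2%N.
Proof.
apply/eqP; rewrite eqn_leq rank_leq_row /=.
by rewrite -{1}(mxrank1 R 2) -(frame_orthonormal U) mxrankM_maxl.
Qed.

Lemma parallel_to_offset (W : 'M[R]_(2, 3)) P Q (t : R) :
  parallel_to W P -> parallel_to W Q -> parallel_to W (P + t *: Q).
Proof.
move=> PW QW i j; rewrite !ffunE opprD addrACA -scalerBr.
by rewrite addmx_sub ?scalemx_sub.
Qed.

End MixedArea.

(** * Curvatures and duality of parallel surfaces *)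

Section Offsets.
Context {R : realType} {K : cell_complex}.
Implicit Types (m s : mesh R K) (t : R) (U : face K -> oplane R).

Lemma mface_offset m t s f :
  mface (offset_mesh m t s) f = mface m f + t *: mface s f.
Proof. by apply/ffunP => k; rewrite !ffunE. Qed.

Lemma mface_opp s f : mface (opp_mesh s) f = -1 *: mface s f.
Proof. by apply/ffunP => k; rewrite !ffunE scaleN1r. Qed.

Lemma parallel_meshes_offset m s t :
  parallel_meshes m s -> parallel_meshes m (offset_mesh m t s).
Proof.
move=> ms i j /ms; apply: contra; rewrite /row_free !eqn_leq !rank_leq_row /=.
move/leq_trans; apply; apply: mxrankS.
rewrite /offset_mesh opprD addrACA -scalerBr col_mx_sub -!addsmxE addsmxSl /=.
by rewrite addmx_sub ?scalemx_sub ?addsmxSl ?addsmxSr.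
Qed.

(** Duality supplies its own plane [V] in each face; nonvanishing of the area of
    the face forces [V] to contain [U f], so the two frames differ by a factor
    [T] and the vanishing carries over to the plane used for the curvatures. *)
Lemma christoffel_dual_mixed_area0 U m m' :
  (forall f, parallel_to (U f) (mface m f)) -> nonvanishing_area U m ->
  christoffel_dual m m' ->
  forall f, mixed_area (U f) (mface m f) (mface m' f) = 0.
Proof.
move=> mU areaN0 [_ _ _ dual] f; have [V [mV _ A0]] := dual f.
have /submxP[T eT] := area_neq0_submx (areaN0 f) (mU f) mV.
by rewrite (mixed_area_frame _ _ eT) A0 mulr0.
Qed.

Lemma christoffel_dual_offset U m s t :
  polyhedral m -> parallel_meshes m s -> common_planes U m s ->
  (forall f,
     mixed_area (U f) (mface m f) (mface (offset_mesh m t s) f) = 0) ->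
  christoffel_dual m (offset_mesh m t s).
Proof.
move=> m_poly ms planes A0.
have oU f : parallel_to (U f) (mface (offset_mesh m t s) f).
  by have [mU sU] := planes f; rewrite mface_offset; apply: parallel_to_offset.
split=> //.
- by move=> f; exists (U f); [apply: rank_frame | apply: oU].
- exact: parallel_meshes_offset.
- by move=> f; exists (U f); split; [have [] := planes f | apply: oU | apply: A0].
Qed.

Lemma mean_curvature_eq U m s f c : area (U f) (mface m f) != 0 ->
  mean_curvature U m s f = c <->
  mixed_area (U f) (mface m f) (mface s f) = - c * area (U f) (mface m f).
Proof.
move=> aN0; rewrite /mean_curvature; split=> [<-|->].
  by rewrite !mulNr divfK ?opprK.
by rewrite !mulNr opprK mulfK.
Qed.

Lemma mixed_area_offset_eq0 U m s f c : c != 0 ->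
  mixed_area (U f) (mface m f) (mface (offset_mesh m c^-1 s) f) = 0 <->
  mixed_area (U f) (mface m f) (mface s f) = - c * area (U f) (mface m f).
Proof.
move=> cN0; rewrite mface_offset mixed_areaDr mixed_areaZr mixed_area_diag.
split=> [/eqP|->]; last by field.
rewrite addrC addr_eq0 => /eqP e.
by rewrite -[LHS](mulVKf cN0) e; ring.
Qed.

End Offsets.

Theorem theorem14 (R : realType) (K : cell_complex) (m s : mesh R K)
    (U : face K -> oplane R) (H0 : R)
    (m_polyhedral : polyhedral m)
    (m_edges : nonzero_edges m)
    (ms_parallel : parallel_meshes m s)
    (ms_planes : common_planes U m s)
    (m_area : nonvanishing_area U m)
    (H0_neq0 : H0 != 0) :
  (const_mean_curvature U m s H0 <->
     koenigs_net m /\ christoffel_dual m (offset_mesh m H0^-1 s)) /\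
  (const_mean_curvature U m s H0 ->
     (nonvanishing_area U (offset_mesh m H0^-1 s) ->
        const_mean_curvature U (offset_mesh m H0^-1 s) (opp_mesh s) H0) /\
     (nonvanishing_area U (offset_mesh m (2 * H0)^-1 s) ->
        const_gauss_curvature U (offset_mesh m (2 * H0)^-1 s) s (4 * H0 ^+ 2) /\
        0 < 4 * H0 ^+ 2)).
Proof.
split; first split.
- move=> cmc.
  have dual : christoffel_dual m (offset_mesh m H0^-1 s).
    apply: (christoffel_dual_offset m_polyhedral ms_parallel ms_planes) => f.
    apply/(mixed_area_offset_eq0 U m s f H0_neq0).
    exact/(mean_curvature_eq _ _ (m_area f)).
  by split=> //; split=> //; exists (offset_mesh m H0^-1 s).
- move=> [_ dual] f.
  apply/(mean_curvature_eq _ _ (m_area f)).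
  apply/(mixed_area_offset_eq0 U m s f H0_neq0).
  by apply: christoffel_dual_mixed_area0 m_area dual f => g; have [] := ms_planes g.
move=> cmc.
have msE f : mixed_area (U f) (mface m f) (mface s f) =
    - H0 * area (U f) (mface m f).
  exact/(mean_curvature_eq _ _ (m_area f)).
split=> [offN0|midN0].
  move=> f; apply/(mean_curvature_eq _ _ (offN0 f)).
  rewrite mface_opp mixed_areaZr mface_offset area_offset.
  rewrite mixed_areaC mixed_areaDr mixed_areaZr mixed_area_diag.
  by rewrite [mixed_area _ (mface s f) _]mixed_areaC msE; field.
split; last by rewrite mulr_gt0 ?exprn_even_gt0.
move=> f; have := midN0 f; rewrite /gauss_curvature mface_offset area_offset msE.
set a := area _ (mface m f); set b := area _ (mface s f).
(* At t = 1 / (2 H0) the contributions of A(m) and A(m, s) cancel, so the area of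
   the mid-surface is proportional to that of the Gauss image. *)
have -> : a + 2 * (2 * H0)^-1 * (- H0 * a) + (2 * H0)^-1 ^+ 2 * b =
  b / (4 * H0 ^+ 2) by field.
rewrite mulf_eq0 negb_or => /andP[bN0 _].
by rewrite invf_div mulrCA mulfV ?mulr1.
Qed.
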